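(* Let $\mu<-\tfrac12$ be real and let $(H_n^{[\mu]})_{n\ge0}$ be the monic generalized Hermite polynomials with parameter $\mu$. If $z\in\mathbb{C}$ is a zero of $H^{[\mu]}_n$ for some $n$, then $$|\operatorname{Im}(z)|\le\left(-\mu-\tfrac12\right)^{1/2}.$$
   Context: The generalized monic Hermite polynomials are $$H^{[\mu]}_{2n}(x)=\sum_{k=0}^n\binom{n+\mu-1/2}{n-k}\frac{(-1)^{n-k}n!}{k!}x^{2k},\qquad H^{[\mu]}_{2n+1}(x)=\sum_{k=0}^n\binom{n+\mu+1/2}{n-k}\frac{(-1)^{n-k}n!}{k!}x^{2k+1},$$ with $\binom{a}{k}=a(a-1)\cdots(a-k+1)/k!$. They satisfy $xH^{[\mu]}_n(x)=H^{[\mu]}_{n+1}(x)+\gamma_nH^{[\mu]}_{n-1}(x)$ with $H_{-1}^{[\mu]}=0$, $H_0^{[\mu]}=1$, $\gamma_{2k}=k$, $\gamma_{2k+1}=k+\tfrac12+\mu$. *)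

(* Defs.v *)
From HB Require Import structures.
From mathcomp Require Import all_boot all_order all_algebra.
From mathcomp Require Import reals complex.
Set Implicit Arguments.
Unset Strict Implicit.
Unset Printing Implicit Defensive.
Import Order.TTheory GRing.Theory Num.Theory.
Local Open Scope ring_scope.

Definition gbinom (R : realType) (a : R) (k : nat) : R :=
  (\prod_(i < k) (a - i%:R)) / (k`!)%:R.

(* The [k]-th coefficient is written with truncated subtraction [m - k], which
   is harmless since [k <= m] throughout the sum. *)
Definition gen_hermite (R : realType) (mu : R) (n : nat) : {poly R} :=
  let m := n./2 in
  if odd n then
    \sum_(k < m.+1)
      (gbinom (m%:R + mu + 1 / 2) (m - k)%N
        * ((-1) ^+ (m - k)%N * (m`!)%:R / (k`!)%:R)) *: 'X^(2 * k + 1)%N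
  else
    \sum_(k < m.+1)
      (gbinom (m%:R + mu - 1 / 2) (m - k)%N
        * ((-1) ^+ (m - k)%N * (m`!)%:R / (k`!)%:R)) *: 'X^(2 * k)%N.

(* Main.v *)
Require Import Defs.
From HB Require Import structures.
From mathcomp Require Import all_boot all_order all_algebra.
From mathcomp Require Import reals complex.
From mathcomp Require Import ring lra.
Set Implicit Arguments.
Unset Strict Implicit.
Unset Printing Implicit Defensive.
Import Order.TTheory GRing.Theory Num.Theory.
Local Open Scope ring_scope.

(** With v_n = H_n(z) and y = Im z, the three-term recurrence gives, for
    D_n = Im (conj v_n * v_(n+1)), the relation
    D_n = y |v_n|^2 + gamma_n D_(n-1).
    As gamma_(2k) >= 0, y D_(2k) >= y^2 |v_(2k)|^2, so by Cauchy-Schwarz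
    y D_(2k) <= |v_(2k+1)|^2, and hence
    y D_(2k+1) >= (y^2 + gamma_(2k+1)) |v_(2k+1)|^2 when gamma_(2k+1) <= 0.
    If y^2 > - mu - 1/2 then y^2 + gamma_(2k+1) > 0 for all k, so
    inductively y D_n > 0, and v_n never vanishes. *)

Section GeneralizedBinomial.
Variable R : realType.
Implicit Types (a : R) (j : nat).

Lemma gbinom0 a : gbinom a 0 = 1.
Proof. by rewrite /gbinom big_ord0 fact0 divr1. Qed.

Lemma gbinom_absorb a j :
  j.+1%:R * gbinom a j.+1 = a * gbinom (a - 1) j.
Proof.
rewrite /gbinom big_ord_recl factS natrM subr0.
have -> : \prod_(i < j) (a - (lift ord0 i)%:R) = \prod_(i < j) (a - 1 - i%:R).
  by apply: eq_bigr => i _; rewrite lift0 -natr1; ring.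
have hj : j.+1%:R != 0 :> R by rewrite pnatr_eq0.
have hf : j`!%:R != 0 :> R by rewrite pnatr_eq0 -lt0n fact_gt0.
by move: (j.+1%:R) hj (j`!%:R) hf => c hc d hd; field; rewrite hc hd.
Qed.

Lemma gbinom_recr a j :
  j.+1%:R * gbinom a j.+1 = (a - j%:R) * gbinom a j.
Proof.
rewrite /gbinom big_ord_recr factS natrM /=.
have hj : j.+1%:R != 0 :> R by rewrite pnatr_eq0.
have hf : j`!%:R != 0 :> R by rewrite pnatr_eq0 -lt0n fact_gt0.
by move: (j.+1%:R) hj (j`!%:R) hf => c hc d hd; field; rewrite hc hd.
Qed.

Lemma gbinom_pascal a j :
  gbinom (a + 1) j.+1 = gbinom a j.+1 + gbinom a j.
Proof.
have hj : j.+1%:R != 0 :> R by rewrite pnatr_eq0.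
apply: (mulfI hj); rewrite mulrDr gbinom_absorb gbinom_recr addrK.
by rewrite -natr1; ring.
Qed.

End GeneralizedBinomial.

Section Laguerre.
Variable R : realType.
Implicit Types (a mu : R) (m k n : nat).

Definition laguerre_coef a m k : R :=
  gbinom a (m - k) * ((-1) ^+ (m - k) * m`!%:R / k`!%:R).

(* Up to sign and the factor [m!], the Laguerre polynomial with parameter
   [a - m]. *)
Definition laguerre a m : {poly R} := \poly_(k < m.+1) laguerre_coef a m k.

(** Pascal's rule, coefficient by coefficient. The top coefficient is separate because
    [laguerre a m] has no term of degree [m.+1]. *)
Lemma laguerre_param_succ a m :
  laguerre (a + 1) m.+1 = laguerre a m.+1 - m.+1%:R *: laguerre a m.
Proof.
apply/polyP => k; rewrite coefB coefZ !coef_poly !ltnS.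
case: (ltngtP k m.+1) => [|hk|->]; last first.
- by rewrite ltnn /laguerre_coef subnn !gbinom0; ring.
- by rewrite leqNgt (ltn_trans _ hk) //= mulr0 subr0.
rewrite ltnS => hk; rewrite hk /laguerre_coef subSn // factS natrM.
by rewrite gbinom_pascal exprS; ring.
Qed.

(** Rests on the absorption identity [gbinom_absorb], which trades a factor of the lower index for
    the factor [a] and a shifted parameter. *)
Lemma laguerre_degree_succ a m :
  laguerre a m.+1 = 'X * laguerre a m - a *: laguerre (a - 1) m.
Proof.
apply/polyP => k; rewrite coefB coefZ coefXM !coef_poly.
case: k => [|k] /=.
  rewrite /laguerre_coef !subn0 factS natrM fact0 exprS sub0r.
  have -> : a * (gbinom (a - 1) m * ((-1) ^+ m * m`!%:R / 1%:R))
          = (a * gbinom (a - 1) m) * ((-1) ^+ m * m`!%:R / 1%:R) by ring.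
  by rewrite -gbinom_absorb; ring.
rewrite !ltnS; case: (ltngtP k m) => [hk|hk|->].
- rewrite /laguerre_coef subSS factS natrM.
  have -> : (m - k = (m - k.+1).+1)%N by rewrite subnSK.
  set j := (m - k.+1)%N.
  (* Splits the factor [m.+1] of [m.+1]![: the share]k.+1[cancels against]k.+1[!] and yields the
     term of ['X * laguerre a m], while the share [j.+1] is absorbed into [gbinom (a - 1) j]. *)
  have hm : m.+1%:R = k.+1%:R + j.+1%:R :> R.
    by rewrite -natrD /j subnSK // addSn subnKC // ltnW.
  set f := gbinom a j.+1; set g := gbinom (a - 1) j.
  have hfg : j.+1%:R * f = a * g by exact: gbinom_absorb.
  have hk0 : k.+1%:R != 0 :> R by rewrite pnatr_eq0.
  have hf : k`!%:R != 0 :> R by rewrite pnatr_eq0 -lt0n fact_gt0.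
  rewrite factS natrM exprS hm.
  have -> : a * (g * ((-1) ^+ j * m`!%:R / (k.+1%:R * k`!%:R)))
          = (a * g) * ((-1) ^+ j * m`!%:R / (k.+1%:R * k`!%:R)) by ring.
  rewrite -hfg; move: (k.+1%:R) hk0 (k`!%:R) hf => c hc d hd.
  by field; rewrite hc hd.
- by rewrite mulr0 subr0.
- rewrite /laguerre_coef !subnn !gbinom0 mulr0 subr0 !expr0 !mul1r.
  by rewrite !divff // pnatr_eq0 -lt0n fact_gt0.
Qed.

Lemma laguerre_comp_sqr a m :
  laguerre a m \Po 'X^2 = \sum_(k < m.+1) laguerre_coef a m k *: 'X^(2 * k).
Proof.
rewrite /laguerre poly_def rmorph_sum /=; apply: eq_bigr => k _.
by rewrite comp_polyZ comp_Xn_poly -exprM.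
Qed.

Lemma gen_hermite_even mu m :
  gen_hermite mu m.*2 = laguerre (m%:R + mu - 1 / 2) m \Po 'X^2.
Proof. by rewrite /gen_hermite odd_double doubleK laguerre_comp_sqr. Qed.

Lemma gen_hermite_odd mu m :
  gen_hermite mu m.*2.+1 = 'X * (laguerre (m%:R + mu + 1 / 2) m \Po 'X^2).
Proof.
rewrite /gen_hermite /= odd_double /= uphalf_double laguerre_comp_sqr mulr_sumr.
by apply: eq_bigr => k _; rewrite -scalerAr addn1 exprS.
Qed.

Definition hermite_gamma mu n : R :=
  if odd n then n./2%:R + 1 / 2 + mu else n./2%:R.

Lemma gen_hermite0 mu : gen_hermite mu 0 = 1.
Proof.
rewrite (gen_hermite_even mu 0) laguerre_comp_sqr big_ord1 /laguerre_coef.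
by rewrite gbinom0 fact0 expr0 divr1 !mul1r scale1r.
Qed.

Lemma gen_hermite1 mu : gen_hermite mu 1 = 'X.
Proof.
rewrite (gen_hermite_odd mu 0) laguerre_comp_sqr big_ord1 /laguerre_coef.
by rewrite gbinom0 fact0 expr0 divr1 !mul1r scale1r mulr1.
Qed.

(** After substituting ['X^2], odd [n] is the parameter shift and even [n] the degree shift of
    [laguerre]; in the latter, [a] is exactly [hermite_gamma mu n.+1]. *)
Lemma gen_hermite_rec mu n :
  gen_hermite mu n.+2 =
  'X * gen_hermite mu n.+1 - hermite_gamma mu n.+1 *: gen_hermite mu n.
Proof.
rewrite /hermite_gamma -(odd_double_half n); set m := n./2.
case: (odd n); rewrite /= ?add1n ?add0n /= odd_double /= ?uphalf_double ?doubleK.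
- rewrite -doubleS gen_hermite_odd gen_hermite_even gen_hermite_odd.
  have -> : m.+1%:R + mu + 1 / 2 = (m%:R + mu + 1 / 2) + 1 :> R.
    by rewrite -natr1; field.
  have -> : m.+1%:R + mu - 1 / 2 = m%:R + mu + 1 / 2 :> R.
    by rewrite -natr1; field.
  rewrite laguerre_param_succ comp_polyB comp_polyZ.
  by rewrite mulrBr scalerAr.
- rewrite -doubleS !gen_hermite_even gen_hermite_odd.
  have -> : m.+1%:R + mu - 1 / 2 = m%:R + mu + 1 / 2 :> R.
    by rewrite -natr1; field.
  rewrite laguerre_degree_succ comp_polyB comp_polyZ comp_polyM comp_polyX.
  have -> : m%:R + mu + 1 / 2 - 1 = m%:R + mu - 1 / 2 :> R by field.
  have -> : m%:R + 1 / 2 + mu = m%:R + mu + 1 / 2 :> R by ring.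
  by rewrite expr2 -mulrA.
Qed.

End Laguerre.

Section ThreeTermRecurrence.
Variable R : realFieldType.

(* [x + i y] and [p n + i q n] stand for the complex spectral parameter and
   the solution of the recurrence. *)
Lemma three_term_im_gt0 (x y : R) (g p q : nat -> R) :
  p 0 = 1 -> q 0 = 0 -> p 1 = x -> q 1 = y ->
  (forall n, p n.+2 = x * p n.+1 - y * q n.+1 - g n.+1 * p n) ->
  (forall n, q n.+2 = x * q n.+1 + y * p n.+1 - g n.+1 * q n) ->
  (forall k, 0 <= g k.*2) -> (forall k, 0 < y ^+ 2 + g k.*2.+1) -> y != 0 ->
  forall n, 0 < y * (p n * q n.+1 - q n * p n.+1).
Proof.
move=> p0 q0 p1 q1 pS qS g_even g_odd y0.
(* The factor [y] is built into [D], so that both signs of [y] are treated at once. *)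
pose D n := y * (p n * q n.+1 - q n * p n.+1).
pose N n := p n ^+ 2 + q n ^+ 2.
have N_ge0 n : 0 <= N n by rewrite addr_ge0 ?sqr_ge0.
have y2 : 0 < y ^+ 2 by rewrite exprn_even_gt0.
have DS n : D n.+1 = y ^+ 2 * N n.+1 + g n.+1 * D n.
  by rewrite /D /N pS qS; ring.
have N_gt0 n : 0 < D n -> 0 < N n.+1.
  move=> hD; rewrite lt0r N_ge0 andbT; apply: contraTneq hD => /eqP.
  rewrite paddr_eq0 ?sqr_ge0 // !sqrf_eq0 => /andP[/eqP hp /eqP hq].
  by rewrite /D hp hq !mulr0 subrr mulr0 ltxx.
(* Cauchy-Schwarz through Lagrange's identity: the defect is a square. *)
have D_sqr n : D n ^+ 2 <= y ^+ 2 * N n * N n.+1.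
  rewrite /D exprMn -mulrA ler_pM2l // /N -subr_ge0.
  have -> : (p n ^+ 2 + q n ^+ 2) * (p n.+1 ^+ 2 + q n.+1 ^+ 2)
      - (p n * q n.+1 - q n * p n.+1) ^+ 2
      = (p n * p n.+1 + q n * q n.+1) ^+ 2 by ring.
  exact: sqr_ge0.
have step_odd k : 0 < D k.*2 -> y ^+ 2 * N k.*2 <= D k.*2 -> 0 < D k.*2.+1.
  move=> hD hN; rewrite DS; have := N_gt0 _ hD; have := g_odd k.
  set c := g _ => hg hN1.
  (* Combining [D_sqr] with [hN] bounds the square of [D k.*2] by [D k.*2 * N k.*2.+1]; then divide
     by [D k.*2]. *)
  have hDN : D k.*2 <= N k.*2.+1.
    rewrite -(ler_pM2l hD) -expr2; apply: (le_trans (D_sqr _)).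
    by rewrite ler_wpM2r.
  have [c0|c0] := leP 0 c.
    exact: ltr_wpDr (mulr_ge0 c0 (ltW hD)) (mulr_gt0 y2 hN1).
  apply: (@lt_le_trans _ _ ((y ^+ 2 + c) * N k.*2.+1)); first exact: mulr_gt0.
  by rewrite mulrDl lerD2l ler_nM2l.
have step_even k : 0 < D k.*2.+1 ->
    0 < D k.+1.*2 /\ y ^+ 2 * N k.+1.*2 <= D k.+1.*2.
  move=> hD; rewrite doubleS DS.
  have hgD : 0 <= g k.*2.+2 * D k.*2.+1.
    by rewrite mulr_ge0 ?(ltW hD) // -doubleS.
  by rewrite lerDl hgD ltr_wpDr // mulr_gt0 // N_gt0.
(* The induction advances by two: the lower bound may fail at odd indices, where [g] can be
   negative, and [step_even] restores it. *)
have D_even k : 0 < D k.*2 /\ y ^+ 2 * N k.*2 <= D k.*2.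
  elim: k => [|k [hD hN]]; last by apply: step_even; apply: step_odd.
  by rewrite double0 /D /N p0 q0 q1 mul1r mul0r subr0 -expr2 expr1n expr0n addr0 mulr1.
move=> n; rewrite -/(D n) -(odd_double_half n).
by case: (odd n); have [hD hN] := D_even n./2; rewrite ?add0n ?add1n //; exact: step_odd.
Qed.

End ThreeTermRecurrence.

Theorem theorem2p24 (R : realType) (mu : R) (hmu : mu < - (1 / 2))
    (n : nat) (z : complex R)
    (hz : root (map_poly (real_complex R) (gen_hermite mu n)) z) :
  `|complex.Im z| <= Num.sqrt (- mu - 1 / 2).
Proof.
(* Ensures that [Num.sqrt] is a genuine root here, not its default value 0. *)
have hc : 0 <= - mu - 1 / 2 by lra.
rewrite leNgt; apply/negP => hlt.
have hy2 : - mu - 1 / 2 < complex.Im z ^+ 2.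
  rewrite -(sqr_sqrtr hc) -(real_normK (num_real (complex.Im z))).
  by rewrite ltr_pXn2r ?nnegrE ?sqrtr_ge0.
pose v k := (map_poly (real_complex R) (gen_hermite mu k)).[z].
have v0 : v 0 = 1 by rewrite /v gen_hermite0 rmorph1 hornerC.
have v1 : v 1 = z by rewrite /v gen_hermite1 map_polyX hornerX.
have vS k : v k.+2 = z * v k.+1 - (hermite_gamma mu k.+1)%:C%C * v k.
  rewrite /v gen_hermite_rec rmorphB rmorphM /= map_polyX map_polyZ.
  by rewrite !hornerE.
have y0 : complex.Im z != 0.
  by apply: contraTneq hy2 => ->; rewrite expr0n /= -leNgt.
have D_gt0 := @three_term_im_gt0 R (complex.Re z) (complex.Im z)
  (hermite_gamma mu) (fun k => complex.Re (v k)) (fun k => complex.Im (v k)).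
(* Index 0 is impossible since [v 0 = 1]; a zero of [v n.+1] makes the positive quantity of index
   [n] vanish. *)
case: n hz => [|n] /eqP; rewrite -/(v _) => hn.
  by move/eqP: hn; rewrite v0 oner_eq0.
suff : 0 < complex.Im z * (complex.Re (v n) * complex.Im (v n.+1)
                   - complex.Im (v n) * complex.Re (v n.+1)).
  by rewrite hn /= !mulr0 subrr mulr0 ltxx.
apply: D_gt0 => //; rewrite ?v0 ?v1 //.
- move=> k; rewrite vS; case: (z) (v k.+1) (v k) => [a b] [c d] [e f] /=; ring.
- move=> k; rewrite vS; case: (z) (v k.+1) (v k) => [a b] [c d] [e f] /=; ring.
- by move=> k; rewrite /hermite_gamma odd_double ler0n.
- move=> k; rewrite /hermite_gamma /= odd_double /= uphalf_double.
  have : 0 <= k%:R :> R by rewrite ler0n.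
  by move: hy2; lra.
Qed.
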